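(* If $K$ is a convex body in $\mathbb{R}^2$ containing the origin in its interior, and $u\in S^1$, then $$\sqrt{V_K(\{u\})}+\sqrt{V_K(\{-u\})}\le\sqrt{V(K)},$$ with equality if and only if $K$ is a trapezoid with two sides parallel to $u^\perp$, and $u^\perp$ contains the intersection of the diagonals.
   Context: A convex body is a compact convex set with non-empty interior; $V(K)$ is its area. $u^\perp$ is the line through the origin orthogonal to $u$. A trapezoid is a convex quadrilateral with at least one pair of parallel sides (parallelograms are included). $h(K,x)=\max\{x\cdot y:y\in K\}$ and $F(K,u)=\{x\in K:x\cdot u=h(K,u)\}$. For a convex body $K\subset\mathbb{R}^2$ containing the origin in its interior, the cone-volume measure $V_K$ is the Borel measure on $S^1$ given by $V_K(\omega)=\frac12\int_{\nu_K^{-1}(\omega)}x\cdot\nu_K(x)\,d\mathcal{H}^{1}(x)$, where $\nu_K$ is the Gauss map defined on the set of boundary points of $K$ having a unique outer unit normal. In particular $V_K(\{u\})=\frac12 h(K,u)\,\mathcal{H}^1(F(K,u))$. *)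

(* Defs.v *)
From HB Require Import structures.
From mathcomp Require Import all_boot all_order all_algebra.
From mathcomp Require Import all_classical all_reals all_analysis.
Set Implicit Arguments.
Unset Strict Implicit.
Unset Printing Implicit Defensive.
Import Order.TTheory GRing.Theory Num.Theory.
Import numFieldNormedType.Exports.
Local Open Scope classical_set_scope.
Local Open Scope ring_scope.

(* The plane is [R * R]: its topology, its measurable structure and its
   Lebesgue measure are the product ones.  The library norm on a product is
   the sup norm, so the Euclidean structure is introduced here. *)

Section euclidean_plane.
Context {R : realType}.
Implicit Types (x y u : R * R) (A : set (R * R)).

Definition dot x y : R := x.1 * y.1 + x.2 * y.2.

Definition det2 x y : R := x.1 * y.2 - x.2 * y.1.

Definition norm2 x : R := Num.sqrt (dot x x).

Definition unit_circle : set (R * R) := [set u | norm2 u = 1].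

Definition perp u : set (R * R) := [set x | dot x u = 0].

Definition area A : \bar R := (lebesgue_measure \x lebesgue_measure)%E A.

Definition convex_hull A : set (R * R) := smallest (@convex_set R (R * R)%type) A.

End euclidean_plane.

Section hausdorff_measure.
Context {R : realType}.
Local Open Scope ereal_scope.
Implicit Types A : set (R * R).

(* The point 0 is added so that the empty set has diameter 0, not -oo. *)
Definition diam A : \bar R :=
  ereal_sup (0 |` [set (norm2 (z.1 - z.2))%:E | z in A `*` A]).

Definition hausdorff1_pre (delta : R) A : \bar R :=
  ereal_inf [set \sum_(0 <= i <oo) diam (U i) |
             U in [set U : (set (R * R))^nat |
                   A `<=` \bigcup_i U i /\ forall i, diam (U i) <= delta%:E]].

(* One-dimensional Hausdorff (outer) measure, normalized so that the measure
   of a segment is its length. *)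
Definition hausdorff1 A : \bar R :=
  ereal_sup [set hausdorff1_pre delta A | delta in [set d : R | (0 < d)%R]].

End hausdorff_measure.

Section convex_bodies.
Context {R : realType}.
Implicit Types (K : set (R * R)) (x u : R * R) (omega : set (R * R)).

Definition convex_body K :=
  [/\ compact K, convex_set K & interior K !=set0].

Definition support_function K x : R := sup [set dot x y | y in K].

Definition support_set K u : set (R * R) :=
  [set x | K x /\ dot x u = support_function K u].

Definition outer_unit_normal K x u := unit_circle u /\ support_set K u x.

Definition regular_boundary K : set (R * R) :=
  [set x | (closure K `\` interior K) x /\ exists! u, outer_unit_normal K x u].

(* Meaningful on [regular_boundary K] only; the value elsewhere is unused. *)
Definition gauss_map K x : R * R := xget 0 (outer_unit_normal K x).

(* [omega] stands for a Borel subset of the unit circle.  The integral of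
   the library only evaluates the set function on sets that are measurable
   for the product structure of [R * R], i.e. on Borel sets, where the outer
   measure [hausdorff1] is a measure. *)
Definition cone_volume_measure K omega : \bar R :=
  (2^-1%:E * \int[hausdorff1]_(x in regular_boundary K `&` gauss_map K @^-1` omega)
               (dot x (gauss_map K x))%:E)%E.

End convex_bodies.

Section trapezoids.
Context {R : realType}.
Implicit Types (K : set (R * R)) (a b c d u : R * R).

(* [a], [b], [c], [d] are the consecutive vertices, listed counterclockwise,
   of a nondegenerate convex quadrilateral: there is a strict left turn at
   each of the four vertices. *)
Definition quadrilateral_vertices a b c d :=
  [/\ 0 < det2 (b - a) (c - b), 0 < det2 (c - b) (d - c),
      0 < det2 (d - c) (a - d) & 0 < det2 (a - d) (b - a)].

Definition convex_quadrilateral K a b c d :=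
  quadrilateral_vertices a b c d /\ K = convex_hull [set a; b; c; d].

(* The labelling starts at an endpoint of one of the parallel sides. *)
Definition trapezoid K a b c d :=
  convex_quadrilateral K a b c d /\ det2 (b - a) (d - c) = 0.

(* [K] is a trapezoid with two sides parallel to [perp u], and [perp u]
   contains the intersection of the diagonals.  Two sides parallel to the
   same line are opposite, so they are [a, b] and [c, d] up to relabelling. *)
Definition trapezoid_centered_along K u :=
  exists a b c d, [/\ trapezoid K a b c d,
    perp u (b - a), perp u (d - c) &
    exists2 p, (convex_hull [set a; c] `&` convex_hull [set b; d]) p & perp u p].

End trapezoids.

(* Main.v *)
Require Import Defs.
From HB Require Import structures.
From mathcomp Require Import all_boot all_order all_algebra.
From mathcomp Require Import all_classical all_reals all_analysis.
From mathcomp Require Import lra ring.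
Set Implicit Arguments.
Unset Strict Implicit.
Unset Printing Implicit Defensive.
Import Order.TTheory GRing.Theory Num.Theory.
Import numFieldNormedType.Exports.
Local Open Scope classical_set_scope.
Local Open Scope ring_scope.

(** Write h and h' for the support numbers of K in the directions u and - u,
    both positive because 0 is interior, and l, l' for the lengths of the two
    faces.  The two cone volumes are h l / 2 and h' l' / 2
    ([cone_volume_facet]), so the left-hand side depends on these four numbers
    only.

    By convexity K contains the hull T of its two faces, a possibly degenerate
    trapezoid of height h + h' and area (h + h') (l + l') / 2
    ([trap_sub_convex], [area_trap]).  The inequality for T is Cauchy-Schwarz,
      sqrt (h l) + sqrt (h' l') <= sqrt ((h + h') (l + l')),
    with equality exactly when h l' = h' l ([sqrt_add_le]).  The inequality for
    K follows from the inclusion of T in K, and it is an equality if and only if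
    T and K have the same area and h l' = h' l.  A closed convex set which is
    strictly larger than T has strictly larger area ([convex_area_lt]), so the
    first condition says that K is T; then l + l' > 0 and the second condition
    makes both faces nondegenerate.  Finally the diagonals of T divide the
    height in the ratio l : l', so h l' = h' l says that they meet on the line
    through 0 orthogonal to u ([centered_trapezoidP]).

    Two facts of measure theory are needed on the way.  The area is computed by
    slicing along u, which requires that the product Lebesgue measure be
    invariant under rotations ([area_preserving_sl2]).  The cone-volume integral
    is taken against one-dimensional Hausdorff measure, which is compared with
    Lebesgue measure along the line carrying the face
    ([lebesgue_measure_preimage_le_hausdorff1],
    [hausdorff1_le_lebesgue_measure]). *)

(** * Lebesgue measure of the plane under area-preserving maps *)

Lemma lebesgue_measure_translate (R : realType) (c : R) (A : set R) :
  measurable A ->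
  lebesgue_measure ((fun x => x + c) @^-1` A) = lebesgue_measure A.
Proof.
move=> mA.
have mf : measurable_fun [set: measurableTypeR R]
    ((fun x : R => x + c) : measurableTypeR R -> measurableTypeR R).
  exact: measurable_realfun.measurable_funD.
pose m := measure_function_pushforward__canonical__measure_function_Measure
  (@lebesgue_measure R) mf.
rewrite [RHS](@lebesgue_measure_unique R m)// => _ [[a b] /= _ <-].
rewrite [RHS](_ : _ = lebesgue_measure `]a - c, b - c]%classic); last first.
  congr lebesgue_measure; apply/seteqP; split => x /=;
  by rewrite !in_itv/= ltrBlDr lerBrDr.
rewrite !lebesgue_measure_itv/= !lte_fin ltrD2r; case: ifP => // _.
by rewrite -!EFinB opprB addrA subrK.
Qed.

(** The plane is second countable: the rectangles with rational corners that
    are contained in an open set cover it. *)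
Lemma open_plane_measurable (R : realType) (A : set (R * R)) :
  open A -> measurable A.
Proof.
move=> oA.
pose Q (q : (rat * rat) * (rat * rat)) : set (R * R) :=
   `]ratr q.1.1, ratr q.1.2[%classic `*` `]ratr q.2.1, ratr q.2.2[%classic.
have -> : A = \bigcup_q (if `[< Q q `<=` A >] then Q q else set0).
  apply/seteqP; split; last first.
    by move=> x [q _ /=]; case: asboolP => // /[apply].
  move=> [x y] Axy.
  have : nbhs (x, y) A by exact: open_nbhs_nbhs.
  rewrite -nbhs_ballE => -[e /= e0 eA].
  have [p px] : exists q : rat, x - e < ratr q < x.
    by apply: rat_in_itvoo; rewrite ltrBlDr ltrDl.
  have [p' p'x] : exists q : rat, x < ratr q < x + e.
    by apply: rat_in_itvoo; rewrite ltrDl.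
  have [q qy] : exists q : rat, y - e < ratr q < y.
    by apply: rat_in_itvoo; rewrite ltrBlDr ltrDl.
  have [q' q'y] : exists q : rat, y < ratr q < y + e.
    by apply: rat_in_itvoo; rewrite ltrDl.
  exists ((p, p'), (q, q')) => //; rewrite asboolT.
    by split; rewrite /= in_itv/=; lra.
  move=> [z w] [/=]; rewrite !in_itv/= => hz hw; apply: eA; split => /=;
  by rewrite /ball/= ltr_distl; lra.
apply: countable_bigcupT_measurable; first exact: countableP.
by move=> q; case: ifP => // _; apply: measurableX; exact: measurable_itv.
Qed.

Lemma closed_plane_measurable (R : realType) (A : set (R * R)) :
  closed A -> measurable A.
Proof.
by move=> /closed_openC/open_plane_measurable/measurableC; rewrite setCK.
Qed.

Section area_invariance.
Context {R : realType}.
Implicit Types A : set (R * R).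
Let mu := (@lebesgue_measure R).

Definition area_preserving (f : R * R -> R * R) :=
  measurable_fun setT f /\
  forall A, measurable A -> area (f @^-1` A) = area A.

Lemma area_preserving_comp f g :
  area_preserving f -> area_preserving g -> area_preserving (f \o g).
Proof.
move=> [mf af] [mg ag]; split; first exact: measurableT_comp.
move=> A mA; rewrite comp_preimage ag ?af// -[X in measurable X]setTI.
exact: mf.
Qed.

(** A shear translates every vertical slice, so this is Fubini together with the
    translation invariance of Lebesgue measure on the line. *)
Lemma area_preserving_shear_snd (c : R) :
  area_preserving (fun x => (x.1, x.2 + c * x.1)).
Proof.
split.
  apply: measurable_fun_pair => //; apply: measurable_realfun.measurable_funD => //.
  exact: measurable_realfun.measurable_funM.
move=> A mA; rewrite /area /product_measure1; apply: eq_integral => x _ /=.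
rewrite -[RHS](@lebesgue_measure_translate _ (c * x)); last exact: measurable_xsection.
by congr lebesgue_measure; apply/seteqP; split => y; rewrite /xsection /= !inE.
Qed.

Lemma area_product_measure2 A : measurable A -> area A = (mu \x^ mu)%E A.
Proof.
move=> mA; rewrite /area.
apply: product_measure_unique => // B C mB mC /=.
exact: product_measure2E.
Qed.

Lemma area_preserving_shear_fst (c : R) :
  area_preserving (fun x => (x.1 + c * x.2, x.2)).
Proof.
have mf : measurable_fun setT (fun x : R * R => (x.1 + c * x.2, x.2)).
  apply: measurable_fun_pair => //; apply: measurable_realfun.measurable_funD => //.
  exact: measurable_realfun.measurable_funM.
split => // A mA; rewrite !area_product_measure2//; last first.
  by rewrite -[X in measurable X]setTI; exact: mf.
rewrite /product_measure2; apply: eq_integral => y _ /=.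
rewrite -[RHS](@lebesgue_measure_translate _ (c * y)); last exact: measurable_ysection.
by congr lebesgue_measure; apply/seteqP; split => x; rewrite /ysection /= !inE.
Qed.

(** When the lower left entry is nonzero, a matrix of determinant 1 is a product
    of three shears. *)
Lemma area_preserving_sl2_neq0 (a b c d : R) : a * d - b * c = 1 -> c != 0 ->
  area_preserving (fun x => (a * x.1 + b * x.2, c * x.1 + d * x.2)).
Proof.
move=> det1 c0.
rewrite (_ : (fun _ => _) =
  (fun x => (x.1 + (a - 1) / c * x.2, x.2)) \o
  ((fun x => (x.1, x.2 + c * x.1)) \o
   (fun x => (x.1 + (d - 1) / c * x.2, x.2)))).
  apply: area_preserving_comp; first exact: area_preserving_shear_fst.
  apply: area_preserving_comp; first exact: area_preserving_shear_snd.
  exact: area_preserving_shear_fst.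
apply/funext => -[x y] /=; congr pair; last by field.
have -> : b = (a * d - 1) / c by rewrite -det1; field.
by field.
Qed.

Lemma area_preserving_sl2 (a b c d : R) : a * d - b * c = 1 ->
  area_preserving (fun x => (a * x.1 + b * x.2, c * x.1 + d * x.2)).
Proof.
move=> det1; have [c0|] := eqVneq c 0; last exact: area_preserving_sl2_neq0.
have a0 : a != 0.
  apply/eqP => a0; move: det1; rewrite a0 c0 mul0r mulr0 subr0 => /esym/eqP.
  by rewrite oner_eq0.
(* A quarter turn moves the entry a, which is nonzero, to the lower left. *)
rewrite (_ : (fun _ => _) =
  (fun x => (0 * x.1 + (- 1) * x.2, 1 * x.1 + 0 * x.2)) \o
  (fun x => (c * x.1 + d * x.2, - a * x.1 + - b * x.2))).
  apply: area_preserving_comp; apply: area_preserving_sl2_neq0.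
  - by ring.
  - exact: oner_neq0.
  - by rewrite -det1; ring.
  - by rewrite oppr_eq0.
by apply/funext => -[x y] /=; congr pair; ring.
Qed.

End area_invariance.

(** * Hausdorff measure along a line *)

Section spread.
Context {R : realType}.
Local Open Scope ereal_scope.

Lemma diam_ge0 (A : set (R * R)) : 0 <= diam A.
Proof. by apply: ereal_sup_ubound; left. Qed.

Lemma norm2_le_diam (A : set (R * R)) x y :
  A x -> A y -> (norm2 (x - y))%:E <= diam A.
Proof. by move=> Ax Ay; apply: ereal_sup_ubound; right; exists (x, y). Qed.

Lemma diam_le (A : set (R * R)) (e : \bar R) : 0 <= e ->
  (forall x y, A x -> A y -> (norm2 (x - y))%:E <= e) -> diam A <= e.
Proof.
move=> e0 eA; apply: ge_ereal_sup => _ [->//|[[x y] [/= Ax Ay] <-]].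
exact: eA.
Qed.

(** As a set function [lebesgue_measure] is the outer measure on all subsets of
    the line, and it is monotone on all of them. *)
Lemma le_lebesgue_measure (B C : set R) :
  B `<=` C -> lebesgue_measure B <= lebesgue_measure C.
Proof. exact: (le_outer_measure (wlength idfun)^*%mu). Qed.

(** A set of spread at most d lies in the interval between its infimum and its
    supremum. *)
Lemma lebesgue_measure_le_spread (B : set R) (d : R) : (0 <= d)%R ->
  (forall x y, B x -> B y -> (x - y <= d)%R) -> lebesgue_measure B <= d%:E.
Proof.
move=> d0 dB; have [->|/set0P[b Bb]] := eqVneq B set0; first by rewrite measure0.
have ubB : has_ubound B by exists (b + d)%R => x Bx; rewrite -lerBlDl dB.
have lbB : has_lbound B by exists (b - d)%R => x Bx; rewrite lerBlDr -lerBlDl dB.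
have BI : B `<=` `[inf B, sup B].
  move=> x Bx; rewrite /= in_itv/=; apply/andP; split.
    exact: ge_inf.
  exact: ub_le_sup.
apply: (le_trans (le_lebesgue_measure BI)).
rewrite lebesgue_measure_itv/= lte_fin; case: ifP => // _.
rewrite -EFinB lee_fin lerBlDl -lerBlDr.
apply: lb_le_inf; first by exists b.
move=> x Bx; rewrite lerBlDr; apply: ge_sup; first by exists b.
by move=> y By; rewrite -lerBlDl dB.
Qed.

End spread.

(** The image of [phi] is a line with its arc-length parametrization. *)
Section hausdorff_line.
Context {R : realType} (phi : R -> R * R).
Hypothesis phi_isometry : forall s t, norm2 (phi s - phi t) = `|s - t|.
Local Open Scope ereal_scope.

Lemma lebesgue_measure_preimage_le_diam (A : set (R * R)) :
  lebesgue_measure (phi @^-1` A) <= diam A.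
Proof.
have [Aoo|Aoo] := eqVneq (diam A) +oo; first by rewrite Aoo leey.
have fA : diam A \is a fin_num.
  by rewrite ge0_fin_numE ?diam_ge0// lt_neqAle Aoo leey.
rewrite -(fineK fA); apply: lebesgue_measure_le_spread.
  by rewrite fine_ge0// diam_ge0.
move=> x y Ax Ay; apply: (le_trans (ler_norm _)).
by rewrite -phi_isometry -lee_fin fineK// norm2_le_diam.
Qed.

(** Every member of a cover of A meets the line in a set of outer Lebesgue
    measure at most its diameter. *)
Lemma lebesgue_measure_preimage_le_hausdorff1 (A : set (R * R)) :
  lebesgue_measure (phi @^-1` A) <= hausdorff1 A.
Proof.
apply: (@le_trans _ _ (hausdorff1_pre 1 A)); last first.
  by apply: ereal_sup_ubound; exists 1%R => //=; exact: ltr01.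
apply: le_ereal_inf_tmp => _ [U [AU _] <-].
apply: (@le_trans _ _ (\sum_(0 <= i <oo) lebesgue_measure (phi @^-1` U i))).
  apply: (@le_trans _ _ (lebesgue_measure (\bigcup_i (phi @^-1` U i)))).
    by apply: le_lebesgue_measure => x /AU[i _ Ui]; exists i.
  exact: (outer_measure_sigma_subadditive (wlength idfun)^*%mu).
by apply: lee_nneseries => // i _; exact: lebesgue_measure_preimage_le_diam.
Qed.

Lemma diam_image_itv_le (E : set R) :
  is_interval E -> diam (phi @` E) <= lebesgue_measure E.
Proof.
move=> iE; apply: diam_le; first exact: measure_ge0.
suff key s t : E s -> E t -> (s <= t)%R ->
    (`|s - t|%R)%:E <= lebesgue_measure E.
  move=> _ _ [s Es <-] [t Et <-]; rewrite phi_isometry.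
  by have [st|/ltW ts] := leP s t; [exact: key|rewrite distrC; exact: key].
move=> Es Et st.
have IE : `[s, t] `<=` E.
  by move=> x; rewrite /= in_itv/= => /(iE _ _ Es Et).
apply: le_trans (le_lebesgue_measure IE).
rewrite lebesgue_measure_itv/= lte_fin distrC ger0_norm ?subr_ge0//.
move: st; rewrite le_eqVlt => /orP[/eqP ->|->]; last by rewrite EFinB.
by rewrite ltxx subrr.
Qed.

(** Half-open, so that the pieces are disjoint and lengths add up exactly. *)
Let piece (c delta : R) (k : nat) : set R :=
  `[(c + k%:R * delta)%R, (c + k.+1%:R * delta)%R[%classic.

Lemma piece_trivIset c delta : (0 < delta)%R ->
  trivIset setT (piece c delta).
Proof.
move=> d0; apply: ltn_trivIset => m n mn; rewrite -subset0 => x /=.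
rewrite /piece /= !in_itv/= => -[/andP[_ xm] /andP[nx _]].
have := le_lt_trans nx xm; rewrite ltrD2l ltr_pM2r// ltr_nat ltnS.
by rewrite leqNgt mn.
Qed.

(** Lebesgue measure is the infimum of the total lengths of covers by
    intervals.  These covers become admissible for [hausdorff1_pre] at scale
    delta after each interval is cut along the pieces of length delta, and
    cutting preserves total length. *)
Lemma hausdorff1_le_lebesgue_measure (A : set (R * R)) (B : set R) c d :
  A `<=` phi @` B -> B `<=` `[c, d] -> hausdorff1 A <= lebesgue_measure B.
Proof.
move=> AB Bcd; apply: ge_ereal_sup => _ [delta /= d0 <-].
apply: le_ereal_inf_tmp => _ [F [mF BF] <-].
(* N pieces reach from c to d; m encodes the interval m %/ N cut by the piece
   m %% N. *)
pose N := (Num.truncn ((d - c) / delta)).+1.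
pose E m := F (m %/ N)%N `&` piece c delta (m %% N)%N.
have FI i : is_interval (F i).
  by have [[a b] /= _ <-] := mF i; exact: interval_is_interval.
have EI m : is_interval (E m).
  move=> s t [Fs Ps] [Ft Pt] x sxt; split; first exact: (FI _ _ _ Fs Ft).
  exact: (@interval_is_interval _ _ _ _ Ps Pt).
apply: (@le_trans _ _ (\sum_(0 <= i <oo) diam (phi @` E i))).
  apply: ereal_inf_lbound; exists (fun i => phi @` E i) => //; split.
    move=> _ /AB[s Bs <-].
    have /andP[cs sd] : (c <= s <= d)%R by have := Bcd _ Bs; rewrite /= in_itv.
    have [i _ Fs] := BF _ Bs.
    have q0 : (0 <= (s - c) / delta)%R by apply: divr_ge0; [rewrite subr_ge0|exact: ltW].
    set k := Num.truncn ((s - c) / delta).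
    have kN : (k < N)%N.
      by rewrite ltnS; apply: le_truncn; rewrite ler_pM2r ?invr_gt0// lerD2r.
    exists (i * N + k)%N => //; exists s => //; rewrite /E.
    rewrite divnMDl// divn_small// addn0 modnMDl modn_small//; split => //.
    have := truncn_itv q0; rewrite -/k ler_pdivlMr// ltr_pdivrMr// => /andP[h1 h2].
    by rewrite /piece /= in_itv/= -lerBrDl h1 -ltrBlDl.
  move=> m; apply: (@le_trans _ _ (lebesgue_measure (E m))).
    exact: diam_image_itv_le.
  apply: lebesgue_measure_le_spread; first exact: ltW.
  move=> x y [_ +] [_]; rewrite /piece /= !in_itv/= => /andP[_ xk] /andP[ky _].
  by move: xk; rewrite -natr1 mulrDl mul1r; lra.
apply: (@le_trans _ _ (\sum_(0 <= i <oo) lebesgue_measure (E i))).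
  by apply: lee_nneseries => *; [exact: diam_ge0|exact: diam_image_itv_le].
apply: lime_le; first by apply: is_cvg_nneseries => *; exact: measure_ge0.
apply: nearW => n.
(* The first n terms are among the first n * N, which group by interval. *)
apply: (@le_trans _ _ (\sum_(0 <= i < n * N) lebesgue_measure (E i))).
  rewrite [leRHS](@big_cat_nat _ _ _ n)//=; last by rewrite leq_pmulr.
  by rewrite leeDl// sume_ge0// => *; exact: measure_ge0.
apply: (@le_trans _ _ (\sum_(0 <= i < n) wlength idfun (F i))); last first.
  by apply: nneseries_lim_ge => *; exact: measure_ge0.
rewrite big_nat_mul; apply: lee_sum => i _.
rewrite -{1}[(i * N)%N]add0n mulSn big_addn addnK.
rewrite (eq_big_nat _ _ (F2 := fun k =>
    lebesgue_measure (F i `&` piece c delta k))); last first.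
  by move=> k kN; rewrite /E divnDMl// divn_small// add0n addnC modnMDl modn_small.
have mI k : measurable (F i `&` piece c delta k : set R).
  apply: measurableI; last exact: measurable_itv.
  exact: measurable_realfun.is_interval_measurable.
have tI : trivIset setT (fun k => F i `&` piece c delta k).
  move=> k l _ _ [x [[_ xk] [_ xl]]].
 by apply: (@piece_trivIset c delta d0) => //; exists x.
rewrite big_mkord.
have /= <- := @measure_bigsetU _ _ _ (@lebesgue_measure R) _ mI tI N.
apply: (@le_trans _ _ (lebesgue_measure (F i))).
  apply: le_lebesgue_measure => x.
  by move=> /(@bigsetU_bigcup R (fun k => F i `&` piece c delta k))[k _ []].
have [[a b] /= _ <-] := mF i.
by rewrite wlength_itv lebesgue_measure_itv.
Qed.

End hausdorff_line.

(** Integral of a constant h over a segment D of the line, with or without its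
    endpoints.  [hausdorff1] is an outer measure only, so the integral is
    computed from its definition as a supremum over simple functions. *)
Section hausdorff_integral.
Context {R : realType} (phi : R -> R * R).
Hypothesis phi_isometry : forall s t, norm2 (phi s - phi t) = `|s - t|.
Hypothesis phi_measurable : measurable_fun setT phi.
Import HBNNSimple.
Local Open Scope ereal_scope.

Lemma hausdorff1_ge0 (A : set (R * R)) : 0 <= hausdorff1 A.
Proof.
apply: le_trans (lebesgue_measure_preimage_le_hausdorff1 phi_isometry A).
exact: measure_ge0.
Qed.

Lemma hausdorff1_set0 : hausdorff1 (set0 : set (R * R)) = 0.
Proof.
apply/eqP; rewrite eq_le hausdorff1_ge0 andbT -(measure0 lebesgue_measure).
by apply: (hausdorff1_le_lebesgue_measure phi_isometry (c := 0%R) (d := 0%R)).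
Qed.

Variables (D : set (R * R)) (h c d : R) (f : R * R -> \bar R).
Hypothesis (h0 : (0 < h)%R) (cd : (c <= d)%R).
Hypothesis mS : measurable (phi @` `]c, d[).
Hypothesis SD : phi @` `]c, d[ `<=` D.
Hypothesis Dcd : D `<=` phi @` `[c, d].
Hypothesis fh : forall x, D x -> f x = h%:E.

(** The level sets of g at positive levels are disjoint subsets of D.  Lebesgue
    measure on the line dominates [hausdorff1] on them and is additive, so the
    weighted sum is at most h times the length of the segment. *)
Lemma sintegral_hausdorff1_le (g : {nnsfun (R * R)%type >-> R}) :
  (forall x, (g x)%:E <= (f \_ D) x) ->
  sintegral hausdorff1 g <= (h * (d - c))%:E.
Proof.
move=> gf.
have gD x : (0 < g x)%R -> D x /\ (g x <= h)%R.
  have := gf x; rewrite /patch; case: ifPn => [|_].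
    by rewrite inE => Dx; rewrite fh// lee_fin.
  by rewrite lee_fin leNgt => /negbTE ->.
pose B r := phi @^-1` (g @^-1` [set r]) `&` `[c, d].
have mB r : measurable (B r).
  apply: measurableI; last exact: measurable_itv.
  by rewrite -[X in measurable X]setTI; exact: phi_measurable.
have fg : finite_set (range g) by exact: fimfunP.
rewrite /sintegral -(fsbig_widen (range g) setT)//=; last first.
  by move=> r [_ gr]; rewrite /= preimage10// hausdorff1_set0 mule0.
apply: (@le_trans _ _ (\sum_(r \in range g) h%:E * lebesgue_measure (B r))).
  apply: lee_fsum => // r [x _ <-]; have [gx0|gx0] := eqVneq (g x) 0%R.
    by rewrite gx0 mul0e mule_ge0 ?measure_ge0// lee_fin ltW.
  have {}gx0 : (0 < g x)%R by rewrite lt_neqAle eq_sym gx0 fun_ge0.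
  apply: lee_pmul; first by rewrite lee_fin ltW.
  - exact: hausdorff1_ge0.
  - by rewrite lee_fin; have [] := gD _ gx0.
  apply: (hausdorff1_le_lebesgue_measure phi_isometry (c := c) (d := d)).
    move=> y /= gy; have [] := gD y; first by rewrite gy.
    by move=> /Dcd[s scd sy] _; exists s => //; split => //=; rewrite sy.
  by move=> s [].
rewrite -ge0_mule_fsumr; last by move=> *; exact: measure_ge0.
have tB : trivIset (range g) B.
  by move=> r s _ _ [x [[/= <- _] [/= <- _]]].
rewrite EFinM lee_pmul2l ?lte_fin//.
have /= <- := @measure_fin_bigcup _ _ _ (@lebesgue_measure R) _ _ _ fg tB
  (fun r _ => mB r).
apply: (@le_trans _ _ (lebesgue_measure `[c, d])).
  by apply: le_lebesgue_measure => x [r _ []].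
rewrite lebesgue_measure_itv/= lte_fin; case: ifP => [_|_]; first by rewrite EFinB.
by rewrite lee_fin subr_ge0.
Qed.

Lemma integral_hausdorff1_segment :
  \int[hausdorff1]_(x in D) f x = (h * (d - c))%:E.
Proof.
have f_ge0 x : 0 <= (f \_ D) x.
  by rewrite /patch; case: ifPn => //; rewrite inE => /fh ->; rewrite lee_fin ltW.
have fpos : (f \_ D)^\+ = f \_ D.
  by apply/funext => x; rewrite funeposE max_l.
have fneg : (f \_ D)^\- = cst 0.
  by apply/funext => x; rewrite funenegE max_r// leeNl oppe0.
rewrite /integral fpos fneg.
rewrite [X in _ - X](_ : _ = 0) ?sube0; last first.
  have s0 (g : {nnsfun (R * R)%type >-> R}) : (forall x, (g x)%:E <= 0) ->
      sintegral hausdorff1 g = 0.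
    move=> g0; rewrite /sintegral fsbig1// => r _.
    have [->|r0] := eqVneq r 0%R; first by rewrite mul0e.
    rewrite preimage10 ?hausdorff1_set0 ?mule0// => -[x _ gx].
    move: r0; rewrite -gx eq_le fun_ge0 andbT.
    by have := g0 x; rewrite lee_fin => ->.
  apply/eqP; rewrite eq_le; apply/andP; split.
    by apply: ge_ereal_sup => _ [g g0 <-]; rewrite s0.
  by apply: ereal_sup_ubound; exists nnsfun0 => //; rewrite s0.
apply/eqP; rewrite eq_le; apply/andP; split.
  by apply: ge_ereal_sup => _ [g g0 <-]; exact: sintegral_hausdorff1_le.
(* The value is attained up to endpoints by h times the indicator of the open
   segment. *)
pose S := phi @` `]c, d[.
pose g := scale_nnsfun (indic_nnsfun R mS) (ltW h0).
have gE x : g x = (h * \1_S x)%R by [].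
apply: (@le_trans _ _ (sintegral hausdorff1 g)); last first.
  apply: ereal_sup_ubound; exists g => // x; rewrite gE indicE.
  have [/set_mem Sx|_] := boolP (x \in S); last by rewrite mulr0.
  by rewrite mulr1 patchT ?fh//; [exact: SD|rewrite inE; exact: SD].
rewrite /sintegral -(fsbig_widen [set h] setT)//=; last first.
  move=> r [_ /= rh]; have [->|r0] := eqVneq r 0%R; first by rewrite mul0e.
  rewrite preimage10 ?hausdorff1_set0 ?mule0// => -[x _ gx].
  have : r = (h * \1_S x)%R by rewrite -gx.
  rewrite indicE; case: (_ \in _) => /= rE.
    by apply: rh; rewrite rE mulr1.
  by move: r0; rewrite rE mulr0 eqxx.
rewrite fsbig_set1 EFinM lee_pmul2l ?lte_fin//.
apply: le_trans (lebesgue_measure_preimage_le_hausdorff1 phi_isometry _).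
apply: (@le_trans _ _ (lebesgue_measure `]c, d[)).
  rewrite lebesgue_measure_itv/= lte_fin.
  by move: cd; rewrite le_eqVlt => /orP[/eqP ->|->]; rewrite ?ltxx ?subrr// EFinB.
apply: le_lebesgue_measure => s scd.
have -> : (phi @^-1` (g @^-1` [set h])) s = (g (phi s) = h) by [].
by rewrite gE indicE mem_set ?mulr1//; exists s.
Qed.

End hausdorff_integral.

(** * Orthonormal frames and support functions *)

Section frame.
Context {R : realType}.
Implicit Types (u v x y : R * R) (K : set (R * R)).

Definition rot u : R * R := (- u.2, u.1).

(** The point with coordinates t along u and s along [rot u]; for a unit vector u
    the coordinates of x are [dot x u] and [dot x (rot u)], by [frameK]. *)
Definition frame u (t s : R) : R * R :=
  (t * u.1 + s * (rot u).1, t * u.2 + s * (rot u).2).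

Lemma unit_circleE u : unit_circle u <-> u.1 * u.1 + u.2 * u.2 = 1.
Proof.
rewrite /unit_circle /norm2 /dot /=; split => [u1|->]; last exact: sqrtr1.
rewrite -[LHS]sqr_sqrtr ?u1 ?expr1n//.
by rewrite addr_ge0// -expr2 sqr_ge0.
Qed.

Lemma unit_circleN u : unit_circle u -> unit_circle (- u).
Proof. by move=> /unit_circleE u1; apply/unit_circleE; rewrite /= !mulrNN. Qed.

Lemma frameN u t s : frame (- u) t s = frame u (- t) (- s).
Proof. by rewrite /frame /=; congr pair; ring. Qed.

Lemma dot_frame u t s v : dot (frame u t s) v = t * dot u v + s * dot (rot u) v.
Proof. by rewrite /dot /=; ring. Qed.

Lemma dotC x y : dot x y = dot y x.
Proof. by rewrite /dot; ring. Qed.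

Lemma dotN u x : dot x (- u) = - dot x u.
Proof. by rewrite /dot /=; ring. Qed.

Section unit_vector.
Variables (u : R * R) (u1 : unit_circle u).
Let uu : u.1 * u.1 + u.2 * u.2 = 1 := (unit_circleE u).1 u1.

Lemma dot_frame_u t s : dot (frame u t s) u = t.
Proof.
rewrite -[RHS]mulr1 -uu /dot /=; ring.
Qed.

Lemma dot_frame_rot t s : dot (frame u t s) (rot u) = s.
Proof.
rewrite -[RHS]mulr1 -uu /dot /=; ring.
Qed.

Lemma frameK x : frame u (dot x u) (dot x (rot u)) = x.
Proof.
case: x => x y; rewrite /frame /dot /=.
by congr pair; [rewrite -[RHS]mulr1|rewrite -[RHS]mulr1]; rewrite -uu; ring.
Qed.

Lemma frame_isometry t s s' : norm2 (frame u t s - frame u t s') = `|s - s'|.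
Proof.
rewrite -sqrtr_sqr /norm2; congr Num.sqrt.
by rewrite -[RHS]mulr1 -uu /dot /=; ring.
Qed.

Lemma measurable_frame t : measurable_fun setT (frame u t).
Proof.
apply: measurable_fun_pair; apply: measurable_realfun.measurable_funD => //;
  exact: measurable_realfun.measurable_funM.
Qed.

Lemma interior_frame K x : interior K x -> exists2 e, 0 < e & K (x + frame u e 0).
Proof.
rewrite /interior /= -nbhs_ballE => -[e /= e0 eK].
(* Plane neighbourhoods are those of the sup norm, and the coordinates of a unit
   vector are at most 1 in absolute value. *)
have e2 : 0 < e / 2 by rewrite divr_gt0.
exists (e / 2) => //; apply: eK.
have uL (w : R) : w * w <= 1 -> `|e / 2 * w| < e.
  move=> ww; have : `|w| <= 1.
    by rewrite -(@ler_pXn2r _ 2)// ?nnegrE// expr1n real_normK ?num_real// expr2.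
  rewrite normrM gtr0_norm// => w1.
  by apply: (@le_lt_trans _ _ (e / 2)); [rewrite ler_piMr// ltW|lra].
have := sqr_ge0 u.1; have := sqr_ge0 u.2; rewrite !expr2.
move=> h2 h1; split => /=.
  rewrite /ball/= opprD addrA subrr add0r normrN mul0r addr0; apply: uL; move: uu; lra.
rewrite /ball/= opprD addrA subrr add0r normrN mul0r addr0; apply: uL; move: uu; lra.
Qed.

End unit_vector.

Lemma continuous_dot u : continuous (fun x => dot x u).
Proof.
move=> x; rewrite /dot; apply: cvgD; apply: cvgMl.
- exact: cvg_fst.
- exact: cvg_snd.
Qed.

Lemma convex_setP K : convex_set K <->
  forall x y l, K x -> K y -> 0 <= l <= 1 -> K (l *: x + (1 - l) *: y).
Proof.
split=> [cK x y l Kx Ky l01|cK x y l].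
  have [l0 l1] := andP l01.
  by have := cK x y (Itv01 l0 l1); rewrite !inE => /(_ Kx Ky).
rewrite !inE => Kx Ky; apply: cK => //.
by rewrite ge0 le1.
Qed.

Lemma frame_conv u l t s t' s' :
  l *: frame u t s + (1 - l) *: frame u t' s' =
  frame u (l * t + (1 - l) * t') (l * s + (1 - l) * s').
Proof. by congr pair; rewrite /= /GRing.scale /=; ring. Qed.

Lemma convex_frame K u t a b s : convex_set K ->
  K (frame u t a) -> K (frame u t b) -> a <= s <= b -> K (frame u t s).
Proof.
move=> /convex_setP cK Ka Kb /andP[as_ sb].
have [ab|ab] := eqVneq a b; first by rewrite (_ : s = a)//; lra.
have ba0 : 0 < b - a by rewrite subr_gt0 lt_neqAle ab; lra.
have l01 : 0 <= (b - s) / (b - a) <= 1.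
  apply/andP; split; first by rewrite divr_ge0 ?(ltW ba0)// subr_ge0.
  by rewrite ler_pdivrMr// mul1r; lra.
have := cK _ _ _ Ka Kb l01; rewrite frame_conv.
by congr (K (frame u _ _)); field; rewrite gt_eqF.
Qed.

Lemma support_functionE K v x : K x ->
  (forall y, K y -> dot y v <= dot x v) -> support_function K v = dot x v.
Proof.
move=> Kx xmax.
have ub : ubound [set dot v y | y in K] (dot x v).
  by move=> _ [y Ky <-]; rewrite dotC; exact: xmax.
have Sx : [set dot v y | y in K] (dot x v) by exists x; rewrite // dotC.
apply/eqP; rewrite eq_le; apply/andP; split.
  by apply: ge_sup => //; exists (dot x v).
by apply: ub_le_sup => //; exists (dot x v).
Qed.

Lemma support_function_max K v : compact K -> K !=set0 ->
  exists x, [/\ K x, dot x v = support_function K v &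
                forall y, K y -> dot y v <= support_function K v].
Proof.
move=> cK K0.
have cf : {within K, continuous (fun x => dot x v)}.
  exact/continuous_subspaceT/continuous_dot.
have [x /set_mem Kx xmax] := compact_EVT_max K0 cK cf.
have {}xmax y : K y -> dot y v <= dot x v by move=> Ky; apply: xmax; rewrite inE.
by exists x; rewrite (support_functionE Kx).
Qed.

End frame.

(** * Cone volume of a face *)

Section facet.
Context {R : realType} (K : set (R * R)).
Hypotheses (K_body : convex_body K) (K_origin : interior K 0).

Let cK : compact K. Proof. by case: K_body. Qed.
Let vK : convex_set K. Proof. by case: K_body. Qed.
Let K0 : K 0. Proof. exact: interior_subset. Qed.

Lemma support_function_gt0 u : unit_circle u -> 0 < support_function K u.
Proof.
move=> u1; have [e e0 Ke] := interior_frame u1 K_origin.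
have [x [_ _ /(_ _ Ke)]] := support_function_max u cK (ex_intro _ _ K0).
by rewrite add0r (dot_frame_u u1); exact: lt_le_trans.
Qed.

(** The face is compact and convex, so its last coordinate ranges over a closed
    interval, whose ends are the maxima along [rot u] and - [rot u]. *)
Lemma facet_frame u : unit_circle u -> exists a b : R, a <= b /\
  forall s, K (frame u (support_function K u) s) <-> a <= s <= b.
Proof.
move=> u1; set h := support_function K u.
have [x0 [Kx0 x0h _]] := support_function_max u cK (ex_intro _ _ K0).
pose F := K `&` [set x | dot x u = h].
have F0 : F !=set0 by exists x0.
have cF : compact F.
  apply: compact_closedI => //; apply: (@closed_comp _ _ (fun x => dot x u) [set h]).
    by move=> x _; exact: continuous_dot.
  exact: closed_eq.
have [b [[Kb bh] bE bmax]] := support_function_max (rot u) cF F0.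
have [a [[Ka ah] aE amax]] := support_function_max (- rot u) cF F0.
have sF s : K (frame u h s) ->
    dot a (rot u) <= s <= dot b (rot u).
  move=> Ks; have Fs : F (frame u h s) by split => //=; exact: dot_frame_u.
  have := bmax _ Fs; have := amax _ Fs.
  by rewrite -aE -bE !dotN lerN2 dot_frame_rot// => -> ->.
exists (dot a (rot u)), (dot b (rot u)); split.
  have := sF (dot a (rot u)); rewrite -{1}ah frameK// => /(_ Ka).
  by rewrite lexx.
move=> s; split; first exact: sF.
by apply: (convex_frame vK); rewrite -?ah ?frameK// ah -bh frameK.
Qed.

(** A relative interior point of the face maximizes v over the face, hence v is
    orthogonal to it and equals u or - u; the latter is excluded since 0 is on
    the inner side. *)
Lemma facet_normal_unique u v (a b s : R) : unit_circle u ->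
  K (frame u (support_function K u) a) -> K (frame u (support_function K u) b) ->
  a < s < b ->
  outer_unit_normal K (frame u (support_function K u) s) v -> v = u.
Proof.
move=> u1; set h := support_function K u => Ka Kb /andP[as_ sb] [v1 [Ks sv]].
have [_ [_ _ vmax]] := support_function_max v cK (ex_intro _ _ K0).
have := vmax _ Ka; have := vmax _ Kb; rewrite -sv !dot_frame !lerD2l.
move=> wb wa; have w0 : dot (rot u) v = 0.
  apply/eqP; rewrite eq_le; apply/andP; split.
    have : (b - s) * dot (rot u) v <= 0 by rewrite mulrBl subr_le0.
    by rewrite pmulr_rle0 ?subr_gt0.
  have : (s - a) * dot (rot u) v >= 0 by rewrite mulrBl subr_ge0.
  by rewrite pmulr_rge0 ?subr_gt0.
have vE : v = frame u (dot v u) 0.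
  by rewrite -[LHS](frameK u1) [dot v (rot u)]dotC w0.
have /unit_circleE vv := v1; have /unit_circleE uu := u1.
have : (dot v u) ^+ 2 = 1.
  have : v.1 * v.1 + v.2 * v.2 = (dot v u) ^+ 2 * (u.1 * u.1 + u.2 * u.2).
    by rewrite {1 2 3 4}vE /=; ring.
  by rewrite vv uu mulr1.
move/eqP; rewrite sqrf_eq1 => /orP[] /eqP vu.
  by rewrite vE vu /frame !mul0r !addr0 !mul1r -surjective_pairing.
have := vmax _ K0; rewrite -sv dot_frame w0 mulr0 addr0 dotC [dot u v]dotC vu.
rewrite {1}/dot /= !mulr0 addr0 mulrN1 oppr_ge0.
by rewrite leNgt support_function_gt0.
Qed.

(** Endpoints of the face may or may not be regular, but the set of regular
    points with normal u always lies between the open and the closed face, and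
    the integrand has the constant value [support_function K u] on it. *)
Lemma cone_volume_facet u (a b : R) : unit_circle u -> a <= b ->
  (forall s, K (frame u (support_function K u) s) <-> a <= s <= b) ->
  cone_volume_measure K [set u] =
    (2^-1 * (support_function K u * (b - a)))%:E.
Proof.
move=> u1 ab; set h := support_function K u => Fh.
have h0 : 0 < h by exact: support_function_gt0.
have [_ [_ _ umax]] := support_function_max u cK (ex_intro _ _ K0).
have normal s : a <= s <= b -> outer_unit_normal K (frame u h s) u.
  by move=> /Fh Ks; split => //; split => //; rewrite dot_frame_u.
have Ka : K (frame u h a) by apply/Fh; rewrite lexx.
have Kb : K (frame u h b) by apply/Fh; rewrite lexx andbT.
set D := regular_boundary K `&` gauss_map K @^-1` [set u].
have Dnormal x : D x -> outer_unit_normal K x u.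
  move=> [[_ [v [nv _]]] /= <-]; rewrite /gauss_map.
  exact: (@xgetPex _ 0 (outer_unit_normal K x) (ex_intro _ v nv)).
rewrite /cone_volume_measure -/D.
rewrite (@integral_hausdorff1_segment _ (frame u h) _ _ D h a b)//.
- exact: frame_isometry.
- exact: measurable_frame.
- have mdot v : measurable_fun setT (fun x : R * R => dot x v).
    apply: measurable_realfun.measurable_funD => //;
      exact: measurable_realfun.measurable_funM.
  rewrite (_ : _ @` _ = (fun x => dot x u) @^-1` [set h] `&`
      (fun x => dot x (rot u)) @^-1` `]a, b[); last first.
    apply/seteqP; split => [_ [s sab <-]|x [/= xh xab]].
      by split => /=; rewrite ?dot_frame_u// dot_frame_rot.
    by exists (dot x (rot u)) => //; rewrite -xh frameK.
  apply: measurableI; rewrite -[X in measurable X]setTI; apply: mdot => //.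
- move=> _ [s /= + <-]; rewrite in_itv/= => /andP[as_ sb].
  have sab : a <= s <= b by rewrite !ltW.
  have nE v : outer_unit_normal K (frame u h s) v -> v = u.
    by apply: (facet_normal_unique u1 Ka Kb); rewrite as_.
  have ns := normal _ sab.
  split; last exact: xget_unique.
  split; last by exists u; split => // v /nE ->.
  split; first by apply: subset_closure; exact/Fh.
  move=> /(interior_frame u1)[e e0 /umax].
  rewrite (_ : dot _ u = h + e); first by rewrite -/h gerDl leNgt e0.
  rewrite -[X in _ = X + _](dot_frame_u u1 h s) -[X in _ = _ + X](dot_frame_u u1 e 0).
  by rewrite /dot /=; ring.
- move=> x /Dnormal[_ [Kx xh]]; exists (dot x (rot u)).
    by rewrite /= in_itv/=; apply/Fh; rewrite /h -xh frameK.
  by rewrite /h -xh frameK.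
- by move=> x Dx; have [_ [_ xh]] := Dnormal _ Dx; move: Dx => [_ /= ->]; rewrite xh.
Qed.

End facet.

(** * Trapezoids with two sides orthogonal to u *)

Section trapezoid_area.
Context {R : realType}.
Implicit Types (u v x : R * R) (K : set (R * R)).

Lemma integral_affine (m n a b : R) : a < b ->
  (\int[lebesgue_measure]_(t in `[a, b]) (m + n * t)%:E =
   ((b - a) * (m + n * ((a + b) / 2)))%:E)%E.
Proof.
move=> ab; pose F t : R := m * t + n / 2 * t ^+ 2.
have dF (t : R) : is_derive t 1 F (m + n * t).
  by apply: is_derive_eq; rewrite !scaler1 /GRing.scale /=; field.
have cF : continuous F.
  move=> t; apply: differentiable_continuous.
  by apply/derivable1_diffP; case: (dF t).
rewrite (@continuous_FTC2 _ (fun t => m + n * t) F)//.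
- by rewrite -EFinB /F; congr EFin; field.
- apply: continuous_subspaceT => t.
  by apply: cvgD; [exact: cvg_cst|apply: cvgMr; exact: cvg_id].
- split => [t _||]; first by case: (dF t).
    exact/cvg_at_right_filter/cF.
  exact/cvg_at_left_filter/cF.
- by move=> t _; rewrite derive1E; exact: derive_val.
Qed.

Lemma closed_halfplane v (r : R) : closed [set x | dot x v <= r].
Proof.
apply: (@closed_comp _ _ (fun x => dot x v) [set t | t <= r]).
  by move=> x _; exact: continuous_dot.
exact: closed_le.
Qed.

Lemma convex_halfplane v (r : R) : convex_set [set x | dot x v <= r].
Proof.
apply/convex_setP => x y l /= xr yr /andP[l0 l1].
rewrite (_ : dot _ v = l * dot x v + (1 - l) * dot y v); last first.
  by rewrite /dot /= /GRing.scale /=; ring.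
rewrite (_ : r = l * r + (1 - l) * r); last by ring.
by apply: lerD; apply: ler_wpM2l => //; rewrite subr_ge0.
Qed.

Lemma convex_setI (A B : set (R * R)) :
  convex_set A -> convex_set B -> convex_set (A `&` B).
Proof.
move=> /convex_setP cA /convex_setP cB.
apply/convex_setP => x y l [Ax Bx] [Ay By] l01.
by split; [exact: cA|exact: cB].
Qed.

(** The trapezoid with vertices [frame u p a], [frame u p b], [frame u (- q) c] and
    [frame u (- q) d] (see [convex_hull_trap]); the equations of the two
    lateral sides are multiplied by the height p + q.  The sides orthogonal to u
    are allowed to be points. *)
Definition trap u (p q a b c d : R) : set (R * R) :=
  [set x | [/\ - q <= dot x u <= p,
    c * (p - dot x u) + a * (dot x u + q) <= (p + q) * dot x (rot u) &
    (p + q) * dot x (rot u) <= d * (p - dot x u) + b * (dot x u + q)]].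

Section trap.
Variables (u : R * R) (p q a b c d : R).
Let T := trap u p q a b c d.

Lemma trap_halfplanesE : T =
  [set x | dot x u <= p] `&` [set x | dot x (- u) <= q] `&`
  ([set x | dot x ((a - c) *: u - (p + q) *: rot u) <= - (c * p + a * q)] `&`
   [set x | dot x ((p + q) *: rot u - (b - d) *: u) <= d * p + b * q]).
Proof.
have dotE x (k l : R) v w : dot x (k *: v - l *: w) = k * dot x v - l * dot x w.
  by rewrite /dot /= /GRing.scale /=; ring.
apply/seteqP; split => x; rewrite /T /trap /= !dotE dotN.
  by move=> [/andP[h1 h2] h3 h4]; split; split; lra.
by move=> [[h1 h2] [h3 h4]]; split; [apply/andP; split| |]; lra.
Qed.

Lemma closed_trap : closed T.
Proof.
rewrite trap_halfplanesE.
by apply: closedI; apply: closedI; exact: closed_halfplane.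
Qed.

Lemma convex_trap : convex_set T.
Proof.
rewrite trap_halfplanesE.
by apply: convex_setI; apply: convex_setI; exact: convex_halfplane.
Qed.

Hypotheses (pq0 : 0 < p + q) (ab : a <= b) (cd : c <= d) (u1 : unit_circle u).

Lemma frame_trap t s : T (frame u t s) <->
  [/\ - q <= t <= p, c * (p - t) + a * (t + q) <= (p + q) * s &
    (p + q) * s <= d * (p - t) + b * (t + q)].
Proof. by rewrite /T /trap /= dot_frame_u// dot_frame_rot. Qed.

Lemma trap_top s : T (frame u p s) <-> a <= s <= b.
Proof.
rewrite frame_trap subrr !mulr0 !add0r ![_ * (p + q)]mulrC !ler_pM2l//.
split=> [[_ -> ->//]|/andP[-> ->]]; split => //.
by rewrite lexx andbT -subr_ge0 opprK ltW.
Qed.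

Lemma trap_bottom s : T (frame u (- q) s) <-> c <= s <= d.
Proof.
rewrite frame_trap opprK addNr !mulr0 !addr0 ![_ * (p + q)]mulrC !ler_pM2l//.
split=> [[_ -> ->//]|/andP[-> ->]]; split => //.
by rewrite lexx -subr_ge0 opprK ltW.
Qed.

Lemma trap_sub_convex K : convex_set K ->
  K (frame u p a) -> K (frame u p b) ->
  K (frame u (- q) c) -> K (frame u (- q) d) -> T `<=` K.
Proof.
move=> vK Ka Kb Kc Kd x [/andP[qt tp] xl xr].
set t := dot x u in qt tp xl xr; set s := dot x (rot u) in xl xr.
have pq := gt_eqF pq0.
have l01 : 0 <= (t + q) / (p + q) <= 1.
  apply/andP; split; first by rewrite divr_ge0 ?(ltW pq0)//; lra.
  by rewrite ler_pdivrMr// mul1r; lra.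
have side y z : K (frame u p y) -> K (frame u (- q) z) ->
    K (frame u t ((z * (p - t) + y * (t + q)) / (p + q))).
  move=> Ky Kz; have := (convex_setP K).1 vK _ _ _ Ky Kz l01; rewrite frame_conv.
  by congr (K (frame u _ _)); field; rewrite pq.
rewrite -(frameK u1 x) -/t -/s.
apply: (convex_frame vK (side _ _ Ka Kc) (side _ _ Kb Kd)).
by rewrite ler_pdivrMr// ler_pdivlMr// ![s * _]mulrC xl xr.
Qed.

Lemma convex_hull_trap :
  convex_hull [set frame u (- q) d; frame u (- q) c;
                   frame u p a; frame u p b] = T.
Proof.
apply/seteqP; split; last first.
  move=> x Tx C [vC sC]; move: x Tx; apply: trap_sub_convex => //; apply: sC.
  - by left; right.
  - by right.
  - by left; left; right.
  - by left; left; left.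
apply: smallest_sub; first exact: convex_trap.
move=> _ [[[->|->]|->]|->].
- by apply/trap_bottom; rewrite lexx andbT.
- by apply/trap_bottom; rewrite lexx.
- by apply/trap_top; rewrite lexx.
- by apply/trap_top; rewrite lexx andbT.
Qed.

End trap.

(** Rotate u to the first basis vector and integrate the length of the slices,
    which is an affine function of the height. *)
Lemma area_trap u p q a b c d : 0 < p + q -> a <= b -> c <= d ->
  unit_circle u ->
  area (trap u p q a b c d) = ((p + q) * ((b - a) + (d - c)) / 2)%:E.
Proof.
move=> pq0 ab cd u1; pose e : R * R := (1, 0).
have mT : measurable (trap e p q a b c d).
  by apply: closed_plane_measurable; exact: closed_trap.
have eE (z : R * R) : (dot z e = z.1) * (dot z (rot e) = z.2).
  by split; rewrite /dot /=; ring.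
have /unit_circleE uu := u1.
have [_ ap] : area_preserving
    (fun x : R * R => (u.1 * x.1 + u.2 * x.2, - u.2 * x.1 + u.1 * x.2)).
  by apply: area_preserving_sl2; rewrite mulrN opprK.
rewrite (_ : trap u p q a b c d =
    (fun x => (u.1 * x.1 + u.2 * x.2, - u.2 * x.1 + u.1 * x.2)) @^-1`
    trap e p q a b c d); last first.
  apply/seteqP; split => x; rewrite /trap /= !eE /=;
  rewrite (_ : u.1 * x.1 + u.2 * x.2 = dot x u); try by rewrite /dot; ring.
    by rewrite (_ : - u.2 * x.1 + u.1 * x.2 = dot x (rot u)) // /dot /=; ring.
  by rewrite (_ : - u.2 * x.1 + u.1 * x.2 = dot x (rot u)) // /dot /=; ring.
rewrite ap// /area /product_measure1.
(* The slice at height t has length m + n * t. *)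
pose m : R := (d * p + b * q - c * p - a * q) / (p + q).
pose n : R := (b - a - (d - c)) / (p + q).
have pqN := gt_eqF pq0.
transitivity (\int[lebesgue_measure]_(t in `[(- q)%R, p]) (m + n * t)%:E)%E; last first.
  rewrite integral_affine; last by lra.
  by congr EFin; rewrite /m /n; field; rewrite pqN.
rewrite [RHS]integral_mkcond; apply: eq_integral => t _ /=.
rewrite /patch; case: ifPn; rewrite ?inE ?notin_setE /= in_itv /= => tqp; last first.
  rewrite (_ : xsection _ _ = set0) ?measure0// -subset0 => s.
  by rewrite /xsection /= inE /trap /= eE => -[].
have pt : 0 <= p - t by lra.
have tq : 0 <= t + q by lra.
have hc := ler_wpM2r pt cd; have ha := ler_wpM2r tq ab.
rewrite (_ : xsection _ _ =
  `[(c * (p - t) + a * (t + q)) / (p + q),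
    (d * (p - t) + b * (t + q)) / (p + q)]%classic).
  rewrite lebesgue_measure_itv /= lte_fin ltr_pM2r ?invr_gt0//.
  case: ltP => h; rewrite -?EFinB; congr EFin; rewrite /m /n.
    by field; rewrite pqN.
  have h' : c * (p - t) + a * (t + q) = d * (p - t) + b * (t + q) by lra.
  transitivity
    ((d * (p - t) + b * (t + q) - (c * (p - t) + a * (t + q))) / (p + q)).
    by rewrite h' subrr mul0r.
  by field; rewrite pqN.
apply/seteqP; split => s; rewrite /xsection /= inE /trap /= !eE /= in_itv /=.
  by move=> [_ h1 h2]; rewrite ler_pdivrMr// ler_pdivlMr// ![s * _]mulrC h1.
by rewrite ler_pdivrMr// ler_pdivlMr// ![s * _]mulrC => /andP[].
Qed.

End trapezoid_area.

(** * Strict monotonicity of the area *)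

Section area_strict.
Context {R : realType}.
Implicit Types (K T A B : set (R * R)) (x : R * R).

Lemma le_area A B : measurable A -> measurable B -> A `<=` B ->
  (area A <= area B)%E.
Proof. by move=> mA mB AB; apply: le_measure; rewrite ?inE. Qed.

Lemma area_open_gt0 A : open A -> A !=set0 -> (0 < area A)%E.
Proof.
move=> oA [x Ax].
have : nbhs x A by exact: open_nbhs_nbhs.
rewrite -nbhs_ballE => -[e /= e0 eA].
pose Q : set (R * R) :=
  `]x.1 - e, x.1 + e[%classic `*` `]x.2 - e, x.2 + e[%classic.
have mQ : measurable Q by apply: measurableX; exact: measurable_itv.
apply: (@lt_le_trans _ _ (area Q)).
  rewrite /area product_measure1E; [|exact: measurable_itv|exact: measurable_itv].
  rewrite /= !lebesgue_measure_itv /= !lte_fin.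
  by rewrite !ifT -?EFinB -?EFinM ?lte_fin; [apply: mulr_gt0| |]; lra.
apply: le_area => //; first exact: open_plane_measurable.
move=> [z w] [/=]; rewrite !in_itv/= => hz hw; apply: eA; split => /=;
by rewrite /ball/= ltr_distl; lra.
Qed.

(** Shrinking K slightly towards 0 moves x into the interior of K. *)
Lemma convex_open_near K x : convex_set K -> interior K 0 -> K x ->
  forall U, open U -> U x -> exists2 y, U y & interior K y.
Proof.
move=> /convex_setP vK; rewrite {1}/interior /= -nbhs_ballE.
move=> -[e /= e0 eK] Kx U oU Ux.
have : nbhs x U by exact: open_nbhs_nbhs.
rewrite -nbhs_ballE => -[r /= r0 rU].
have n1 := normr_ge0 x.1; have n2 := normr_ge0 x.2.
have den0 : 0 < r + `|x.1| + `|x.2| by lra.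
(* Small enough for (1 - k) *: x to lie in the ball of radius r around x. *)
pose k : R := r / (r + `|x.1| + `|x.2|).
have k0 : 0 < k by rewrite divr_gt0.
have k1 : k <= 1 by rewrite ler_pdivrMr// mul1r; lra.
have kr (w : R) : `|w| <= `|x.1| + `|x.2| -> `|k * w| < r.
  by move=> wx; rewrite normrM gtr0_norm// mulrAC ltr_pdivrMr// ltr_pM2l//; lra.
exists ((1 - k) *: x).
  apply: rU; split; rewrite /ball /= /GRing.scale /=.
    by rewrite (_ : _ - _ = k * x.1); [apply: kr; lra|ring].
  by rewrite (_ : _ - _ = k * x.2); [apply: kr; lra|ring].
rewrite /interior /= -nbhs_ballE; exists (k * e) => /=; first exact: mulr_gt0.
move=> y [y1 y2].
(* The ball of radius k * e around (1 - k) *: x is a combination of x and of the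
   ball of radius e around 0. *)
pose z : R * R := k^-1 *: (y - (1 - k) *: x).
have -> : y = k *: z + (1 - k) *: x.
  by rewrite /z scalerA mulfV ?gt_eqF// scale1r subrK.
have sm (w v : R) : `|(1 - k) * v - w| < k * e ->
    `|0 - k^-1 * (w - (1 - k) * v)| < e.
  move=> h; rewrite sub0r normrN normrM gtr0_norm ?invr_gt0//.
  by rewrite mulrC ltr_pdivrMr// [e * k]mulrC distrC.
apply: vK => //; last by rewrite (ltW k0).
by apply: eK; split; exact: sm.
Qed.

(** The part of the interior of K outside T is open, and nonempty by
    [convex_open_near]. *)
Lemma convex_area_lt K T : convex_set K -> closed K -> interior K 0 ->
  closed T -> T `<=` K -> area T \is a fin_num -> T <> K ->
  (area T < area K)%E.
Proof.
move=> vK cK iK cT TK fT TnK.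
have [x Kx Tx] : exists2 x, K x & ~ T x.
  apply: contrapT => /forall2NP nex; apply: TnK; apply/seteqP; split => // x Kx.
  by have [|/contrapT] := nex x.
have oU : open (~` T `&` interior K).
  by apply: openI; [exact: closed_openC|exact: open_interior].
have [y Ty iy] := convex_open_near vK iK Kx (closed_openC cT) Tx.
have gt0 : (0 < area (~` T `&` interior K))%E.
  by apply: area_open_gt0 => //; exists y.
have mT := closed_plane_measurable cT; have mU := open_plane_measurable oU.
apply: (@lt_le_trans _ _ (area (T `|` (~` T `&` interior K)))).
  rewrite [ltRHS](measureU (lebesgue_measure \x lebesgue_measure)%E)//.
    by rewrite lteDl.
  by rewrite setIA setICr set0I.
apply: le_area; [exact: measurableU|exact: closed_plane_measurable|].
by move=> z [/TK//|[_]]; exact: interior_subset.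
Qed.

End area_strict.

(** * Trapezoids whose diagonals meet on the orthogonal line *)

Section centered_trapezoid.
Context {R : realType}.
Implicit Types (K : set (R * R)) (x y u : R * R).

Lemma det2_frame u t s t' s' : unit_circle u ->
  det2 (frame u t s) (frame u t' s') = t * s' - s * t'.
Proof.
move=> /unit_circleE uu; rewrite -[RHS]mulr1 -uu /det2 /=; ring.
Qed.

Lemma frameB u t s t' s' :
  frame u t s - frame u t' s' = frame u (t - t') (s - s').
Proof. by congr pair; rewrite /=; ring. Qed.

Lemma convex_hull2 x y (l : R) : 0 <= l <= 1 ->
  convex_hull [set x; y] (l *: x + (1 - l) *: y).
Proof.
by move=> l01 C [/convex_setP vC sC]; apply: vC => //; apply: sC; [left|right].
Qed.

(** The line through two points is convex. *)
Lemma convex_hull2_line u t s t' s' x : unit_circle u ->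
  convex_hull [set frame u t s; frame u t' s'] x ->
  (dot x (rot u) - s) * (t' - t) = (dot x u - t) * (s' - s).
Proof.
move=> u1 /(_ [set z | (dot z (rot u) - s) * (t' - t) =
                      (dot z u - t) * (s' - s)]); apply; split; last first.
  by move=> _ [->|->] /=; rewrite dot_frame_u// dot_frame_rot//; ring.
apply/convex_setP => y z l /= hy hz _.
have dotE v : dot (l *: y + (1 - l) *: z) v = l * dot y v + (1 - l) * dot z v.
  by rewrite /dot /= /GRing.scale /=; ring.
rewrite !dotE.
transitivity (l * ((dot y (rot u) - s) * (t' - t)) +
  (1 - l) * ((dot z (rot u) - s) * (t' - t))); first by ring.
by rewrite hy hz; ring.
Qed.

(** In coordinates the diagonals reach the height 0 at s (p + q) = p d + q a and
    s (p + q) = p c + q b, whence the relation p (d - c) = q (b - a).  It forces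
    p and q, whose sum is positive, to be both positive, so that the common
    point does lie between the vertices. *)
Lemma centered_trapezoidP K u : unit_circle u ->
  trapezoid_centered_along K u <->
  exists p q a b c d : R, [/\ 0 < p + q, a < b, c < d, p * (d - c) = q * (b - a)
    & K = trap u p q a b c d].
Proof.
move=> u1; split; last first.
  move=> [p [q [a [b [c [d [pq0 ab cd pqE ->]]]]]]].
  exists (frame u (- q) d), (frame u (- q) c), (frame u p a), (frame u p b).
  rewrite /trapezoid /convex_quadrilateral /quadrilateral_vertices.
  rewrite !frameB !det2_frame// /perp /= !dot_frame_u// !subrr.
  split => //.
    split; last by ring.
    split; last by rewrite convex_hull_trap// ltW.
    have : 0 < (p + q) * (d - c) by rewrite mulr_gt0 ?subr_gt0.
    have : 0 < (p + q) * (b - a) by rewrite mulr_gt0 ?subr_gt0.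
    by split; lra.
  have pqN := gt_eqF pq0.
  have p0 : 0 < p.
    have : 0 < p * ((b - a) + (d - c)).
      by rewrite mulrDr pqE -mulrDl mulr_gt0 ?subr_gt0.
    by rewrite pmulr_lgt0 // addr_gt0 ?subr_gt0.
  have q0 : 0 < q.
    have : 0 < q * (b - a) by rewrite -pqE mulr_gt0 ?subr_gt0.
    by rewrite pmulr_lgt0 ?subr_gt0.
  have l01 : 0 <= p / (p + q) <= 1.
    apply/andP; split; first by rewrite divr_ge0 // ltW.
    by rewrite ler_pdivrMr// mul1r; lra.
  have dE : d = c + q * (b - a) / p by rewrite -pqE; field; rewrite gt_eqF.
  exists (frame u 0 ((p * d + q * a) / (p + q))); last exact: dot_frame_u.
  split.
    have := @convex_hull2 (frame u (- q) d) (frame u p a) _ l01.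
    by rewrite frame_conv; congr (_ (frame u _ _)); field; rewrite pqN.
  have := @convex_hull2 (frame u (- q) c) (frame u p b) _ l01.
  rewrite frame_conv; congr (_ (frame u _ _)); first by field; rewrite pqN.
  by rewrite dE; field; rewrite pqN gt_eqF.
(* One of the two sides orthogonal to u lies above the other; exchanging them
   preserves the counterclockwise labelling. *)
have above (x y z w m : R * R) :
    quadrilateral_vertices x y z w -> perp u (y - x) -> perp u (w - z) ->
    convex_hull [set x; z] m -> convex_hull [set y; w] m -> perp u m ->
    dot y u < dot z u -> K = convex_hull [set x; y; z; w] ->
  exists p q a b c d : R, [/\ 0 < p + q, a < b, c < d, p * (d - c) = q * (b - a)
    & K = trap u p q a b c d].
  have E (v : R * R) : v = frame u (dot v u) (dot v (rot u)) by rewrite frameK.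
  rewrite (E x) (E y) (E z) (E w).
  move: (dot x u) (dot y u) (dot z u) (dot w u) (dot x (rot u))
    (dot y (rot u)) (dot z (rot u)) (dot w (rot u)) => tx ty tz tw sx sy sz sw.
  rewrite /quadrilateral_vertices /perp /= !frameB !det2_frame// !dot_frame_u//.
  move=> -[d1 d2 _ _] /subr0_eq yx /subr0_eq wz.
  move: d1 d2; rewrite {}yx {}wz !subrr mul0r mulr0 sub0r subr0.
  move=> d1 d2 /(convex_hull2_line u1) e1 /(convex_hull2_line u1) e2 m0 yz KE.
  have tzx0 : 0 < tz - tx by rewrite subr_gt0.
  have xy : sy < sx by move: d1; rewrite -mulNr opprB pmulr_lgt0 ?subr_gt0.
  have zw : sz < sw by move: d2; rewrite pmulr_rgt0 ?subr_gt0.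
  exists tz, (- tx), sz, sw, sy, sx; split=> //.
    by rewrite m0 in e1 e2; lra.
  by rewrite KE -convex_hull_trap ?ltW// opprK.
move=> [x [y [z [w [[[qv KE] _] yx wz [m [mxz myw] m0]]]]]].
have [yz|zy|yz] := ltgtP (dot y u) (dot z u).
- exact: (above x y z w m).
- apply: (above z w x y m) => //; first by case: qv.
  + by rewrite setUC.
  + by rewrite setUC.
  + by move: yx wz zy; rewrite /perp /dot /=; lra.
  + rewrite KE; congr convex_hull; apply/seteqP.
    by split => v; rewrite /setU /set1 /=; tauto.
- case: qv => + _ _ _.
  have xy : dot x u = dot y u by move: yx; rewrite /perp /dot /=; lra.
  rewrite -(frameK u1 x) -(frameK u1 y) -(frameK u1 z) !frameB det2_frame//.
  by rewrite xy yz !subrr mul0r mulr0 subrr ltxx.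
Qed.

End centered_trapezoid.

(** * The inequality *)

Section main_inequality.
Context {R : realType}.

(** The squares of the two sides differ by
    (sqrt (p B / 2) - sqrt (q A / 2)) ^ 2. *)
Lemma sqrt_add_le (p q A B : R) : 0 <= p -> 0 <= q -> 0 <= A -> 0 <= B ->
  Num.sqrt (2^-1 * (p * A)) + Num.sqrt (2^-1 * (q * B)) <=
    Num.sqrt ((p + q) * (A + B) / 2) ?= iff (p * B == q * A).
Proof.
move=> p0 q0 A0 B0.
pose s (a b : R) : R := Num.sqrt (2^-1 * (a * b)).
have s0 a b : 0 <= s a b by exact: sqrtr_ge0.
have sE a b : 0 <= a -> 0 <= b -> s a b ^+ 2 = 2^-1 * (a * b).
  by move=> a0 b0; rewrite sqr_sqrtr// mulr_ge0 ?mulr_ge0// invr_ge0.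
have cross : s p A * s q B = s p B * s q A.
  by rewrite /s -!sqrtrM ?mulr_ge0 ?invr_ge0//; congr Num.sqrt; ring.
have S0 : 0 <= (p + q) * (A + B) / 2.
  by rewrite divr_ge0// mulr_ge0// addr_ge0.
have SE : (p + q) * (A + B) / 2 = (s p A + s q B) ^+ 2 + (s p B - s q A) ^+ 2.
  have -> : (s p A + s q B) ^+ 2 + (s p B - s q A) ^+ 2 =
    s p A ^+ 2 + s q B ^+ 2 + s p B ^+ 2 + s q A ^+ 2 +
    2 * (s p A * s q B - s p B * s q A) by ring.
  by rewrite !sE// cross; field.
have pBqA : (p * B == q * A) = (s p B - s q A == 0).
  rewrite subr_eq0 -[RHS](@eqrXn2 _ 2)// !sE//.
  by rewrite (inj_eq (mulfI _))// invr_neq0.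
rewrite -/(s p A) -/(s q B).
have -> : s p A + s q B = Num.sqrt ((s p A + s q B) ^+ 2).
  by rewrite sqrtr_sqr ger0_norm// addr_ge0.
split; first by rewrite ler_sqrt// SE lerDl sqr_ge0.
by rewrite eqr_sqrt ?sqr_ge0// SE -subr_eq0 opprD addrA subrr sub0r oppr_eq0
  sqrf_eq0 pBqA.
Qed.

End main_inequality.

Theorem lemma6p3 (R : realType) (K : set (R * R)) (u : R * R)
    (K_body : convex_body K) (K_origin : interior K 0) (u_unit : unit_circle u) :
  (sqrte (cone_volume_measure K [set u]) +
     sqrte (cone_volume_measure K [set (- u)%R]) <= sqrte (area K))%E /\
  ((sqrte (cone_volume_measure K [set u]) +
     sqrte (cone_volume_measure K [set (- u)%R]) = sqrte (area K))%E <->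
   trapezoid_centered_along K u).
Proof.
have [cK vK _] := K_body.
have clK : closed K.
  by apply: compact_closed => //; exact: norm_hausdorff.
have mK := closed_plane_measurable clK.
have nu_unit := unit_circleN u_unit.
set p := support_function K u; set q := support_function K (- u).
have p0 : 0 < p by exact: support_function_gt0.
have q0 : 0 < q by exact: support_function_gt0.
have pq0 : 0 < p + q by exact: addr_gt0.
have [a [b [ab top]]] := facet_frame K_body K_origin u_unit.
have [c [d [cd bottom]]] : exists c d : R, c <= d /\
    forall s, K (frame u (- q) s) <-> c <= s <= d.
  have [d [c [dc botN]]] := facet_frame K_body K_origin nu_unit.
  exists (- c), (- d); split; first by rewrite lerN2.
  move=> s; rewrite -[X in K (frame _ _ X)]opprK -frameN; apply: (iff_trans (botN _)).
  by rewrite lerNl lerNr andbC.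
have VE : cone_volume_measure K [set u] = (2^-1 * (p * (b - a)))%:E.
  exact: cone_volume_facet.
have VNE : cone_volume_measure K [set - u] = (2^-1 * (q * (d - c)))%:E.
  rewrite (_ : d - c = - c - (- d)); last by ring.
  apply: cone_volume_facet => //; first by rewrite lerN2.
  move=> s; rewrite frameN; apply: (iff_trans (bottom _)).
  by rewrite lerNr lerNl andbC.
pose T := trap u p q a b c d.
have TK : T `<=` K.
  by apply: trap_sub_convex => //; [apply/top|apply/top|apply/bottom|apply/bottom];
    rewrite lexx ?andbT.
have TE : area T = ((p + q) * ((b - a) + (d - c)) / 2)%:E by exact: area_trap.
have cT : closed T by exact: closed_trap.
have TleK : (area T <= area K)%E.
  by apply: le_area => //; exact: closed_plane_measurable.
have ba0 : 0 <= b - a by rewrite subr_ge0.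
have dc0 : 0 <= d - c by rewrite subr_ge0.
have [le_iff eq_iff] := sqrt_add_le (ltW p0) (ltW q0) ba0 dc0.
have aK0 : (0 <= area K)%E by exact: measure_ge0.
have leT : (sqrte (cone_volume_measure K [set u]) +
    sqrte (cone_volume_measure K [set (- u)%R]) <= sqrte (area T))%E.
  by rewrite VE VNE TE /= -EFinD lee_fin.
have leTK : (sqrte (area T) <= sqrte (area K))%E by rewrite lee_sqrt.
split; first exact: le_trans leTK.
rewrite centered_trapezoidP//; split.
  move=> eqK.
  have KT : area K = area T.
    have aT0 : (0 <= area T)%E by exact: measure_ge0.
    by apply/eqP; rewrite eq_le TleK andbT -lee_sqrt// -eqK.
  have TKE : T = K.
    apply: contrapT => TnK.
    have fT : area T \is a fin_num by rewrite TE.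
    by have := convex_area_lt vK clK K_origin cT TK fT TnK; rewrite KT ltxx.
  have pqE : p * (d - c) = q * (b - a).
    by apply/eqP; rewrite -eq_iff; move: eqK; rewrite VE VNE KT TE /= -EFinD => -[->].
  have sum0 : 0 < (b - a) + (d - c).
    have : (0 < area K)%E.
      apply: (@lt_le_trans _ _ (area (interior K))).
        apply: area_open_gt0; first exact: open_interior.
        by exists 0.
      apply: le_area; [|exact: mK|exact: interior_subset].
      by apply: open_plane_measurable; exact: open_interior.
    by rewrite KT TE lte_fin pmulr_lgt0 ?invr_gt0// pmulr_rgt0.
  have dca : d - c = q * (b - a) / p by rewrite -pqE; field; rewrite gt_eqF.
  have ba : 0 < b - a.
    rewrite lt_neqAle ba0 andbT eq_sym; apply/eqP => ba.
    by move: sum0; rewrite dca ba mulr0 mul0r addr0 ltxx.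
  exists p, q, a, b, c, d; split => //; first by rewrite -subr_gt0.
  by rewrite -subr_gt0 dca divr_gt0// mulr_gt0.
move=> [p' [q' [a' [b' [c' [d' [pq' ab' cd' pqE' KE]]]]]]].
have top' s : K (frame u p' s) <-> a' <= s <= b' by rewrite KE; exact: trap_top.
have bottom' s : K (frame u (- q') s) <-> c' <= s <= d'.
  by rewrite KE; exact: trap_bottom.
have pp' : p = p'.
  rewrite /p (@support_functionE _ K u (frame u p' a')); first exact: dot_frame_u.
    by apply/top'; rewrite lexx ltW.
  by move=> y; rewrite KE => -[/andP[_ yp] _ _]; rewrite dot_frame_u.
have qq' : q = q'.
  rewrite /q (@support_functionE _ K (- u) (frame u (- q') c')).
  - by rewrite dotN dot_frame_u// opprK.
  - by apply/bottom'; rewrite lexx ltW.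
  - move=> y; rewrite KE => -[/andP[yq _] _ _].
    by rewrite !dotN dot_frame_u// opprK lerNl.
move: pqE' KE top' bottom'; rewrite -{}pp' -{}qq' => pqE' KE top' bottom'.
(* The faces of K in the directions u and - u are the sides of the trapezoid. *)
have itvE (l r l' r' : R) : l <= r -> l' <= r' ->
    (forall s, l <= s <= r <-> l' <= s <= r') -> l = l' /\ r = r'.
  move=> lr lr' H.
  have := (H l).1; have := (H r).1; have := (H l').2; have := (H r').2.
  rewrite !lexx lr lr' => /(_ isT)/andP[_ h1] /(_ isT)/andP[h2 _].
  move=> /(_ isT)/andP[_ h3] /(_ isT)/andP[h4 _].
  by split; apply/eqP; rewrite eq_le ?h1 ?h2 ?h3 ?h4.
have [aE bE] : a = a' /\ b = b'.
  apply: itvE => //; first exact: ltW.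
  by move=> s; rewrite -top'; exact: iff_sym.
have [cE dE] : c = c' /\ d = d'.
  apply: itvE => //; first exact: ltW.
  by move=> s; rewrite -bottom'; exact: iff_sym.
subst a' b' c' d'.
have -> : area K = area T by rewrite KE.
rewrite VE VNE TE /= -EFinD; congr EFin.
by apply/eqP; rewrite eq_iff pqE'.
Qed.
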